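(* Let $n\ge 3$ be an integer, $0<m<\frac{n-2}{n}$, $\alpha,\beta\in\mathbb{R}$, $\gamma=\frac{2}{1-m}$ and $\eta>0$. Suppose there exists a radially symmetric solution $f$ of $$\Delta (f^m/m)+\alpha f+\beta x\cdot\nabla f=0,\quad f>0,\quad\text{ in }\mathbb{R}^n\setminus\{0\}$$ which satisfies $$\lim_{|x|\to 0}|x|^{\gamma}f(x)=\eta.$$ Then $$\left(\alpha-\frac{2\beta}{1-m}\right)\eta^{1-m}=\frac{2(n-2-nm)}{(1-m)^2}.$$
   Context: ''Solution'' means a classical (twice continuously differentiable) positive function satisfying the equation pointwise on $\mathbb{R}^n\setminus\{0\}$. Radially symmetric means that $f(x)$ depends only on $|x|$. *)

(* Defs.v *)
From HB Require Import structures.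
From mathcomp Require Import all_boot all_order all_algebra.
From mathcomp Require Import all_classical all_reals all_analysis.
Set Implicit Arguments.
Unset Strict Implicit.
Unset Printing Implicit Defensive.
Import Order.TTheory GRing.Theory Num.Theory.
Import numFieldNormedType.Exports.
Local Open Scope classical_set_scope.
Local Open Scope ring_scope.

Definition dot (R : realType) (n : nat) (x y : 'rV[R]_n) : R :=
  \sum_(i < n) x ord0 i * y ord0 i.

(* The library norm `|x| on 'rV[R]_n is the sup norm, hence this definition;
   the two norms induce the same topology. *)
Definition enorm (R : realType) (n : nat) (x : 'rV[R]_n) : R :=
  Num.sqrt (dot x x).

Definition partial (R : realType) (n : nat) (i : 'I_n) (f : 'rV[R]_n -> R) :
  'rV[R]_n -> R := 'D_(delta_mx ord0 i) f.

Definition grad (R : realType) (n : nat) (f : 'rV[R]_n -> R) (x : 'rV[R]_n) :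
  'rV[R]_n := \row_i partial i f x.

Definition laplacian (R : realType) (n : nat) (f : 'rV[R]_n -> R)
  (x : 'rV[R]_n) : R := \sum_(i < n) partial i (partial i f) x.

(* C1_on and C2_on are meant for open U, where derivatives at points of U only
   depend on the values of f on U. *)
Definition C1_on (R : realType) (n : nat) (U : set 'rV[R]_n)
  (f : 'rV[R]_n -> R) : Prop :=
  forall (x : 'rV[R]_n) (i : 'I_n), U x ->
    derivable f x (delta_mx ord0 i) /\ {for x, continuous (partial i f)}.

Definition C2_on (R : realType) (n : nat) (U : set 'rV[R]_n)
  (f : 'rV[R]_n -> R) : Prop :=
  C1_on U f /\ forall i : 'I_n, C1_on U (partial i f).

Definition radial (R : realType) (n : nat) (f : 'rV[R]_n -> R) : Prop :=
  forall x y : 'rV[R]_n, x != 0 -> y != 0 -> enorm x = enorm y -> f x = f y.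

(* f is a total function; its value at the origin is irrelevant. *)
Definition solution (R : realType) (n : nat) (m alpha beta : R)
  (f : 'rV[R]_n -> R) : Prop :=
  [/\ C2_on [set x | x != 0] f,
      forall x, x != 0 -> 0 < f x
    & forall x, x != 0 ->
        laplacian (fun y => f y `^ m / m) x + alpha * f x
          + beta * dot x (grad f x) = 0].

(* Main.v *)
Require Import Defs.
From HB Require Import structures.
From mathcomp Require Import all_boot all_order all_algebra.
From mathcomp Require Import all_classical all_reals all_analysis.
From mathcomp Require Import ring lra.
Import Order.TTheory GRing.Theory Num.Theory.
Import numFieldNormedType.Exports.
Local Open Scope classical_set_scope.
Local Open Scope ring_scope.

(** Along a ray, the profile g(t) of the radial solution and u = g^m / m satisfy
      u'' + (n - 1) u' / t + alpha g + beta t g' = 0,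
    that is, the flux W(t) = t^(n-1) u'(t) + beta t^n g(t) satisfies
      W'(t) = (n beta - alpha) t^(n-1) g(t).
    The hypothesis t^gamma g(t) --> eta controls g, hence W', near 0, but says
    nothing pointwise about u' and hence about W.  The value of eta comes from
    computing the size of W near 0 in two ways, with 2 < gamma < n:

    - u(t) t^(gamma-2) = (t^gamma g(t))^m / m --> eta^m / m, since
      gamma m = gamma - 2.  By Cauchy's mean value theorem on [t, 2t], there are
      points x arbitrarily close to 0 where u'(x) x^(gamma-1) is close to
      (2 - gamma) eta^m / m (lemma derive_powR_cluster), so that
      W(x) x^(gamma-n) is close to l := (2 - gamma) eta^m / m + beta eta.

    - W'(t) t^(gamma-n+1) --> (n beta - alpha) eta.  Since n - gamma > 0, the
      mean value theorem between two such points x of very different sizes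
      forces (n - gamma) l = (n beta - alpha) eta
      (lemma cluster_powR_derive_lim).  In particular no constant of integration
      appears: it would make W(x) x^(gamma-n) blow up.

    Solving this equation for eta gives the claim.  The radial ODE itself comes
    from the first and second partial derivatives of a function of the Euclidean
    norm (lemma laplacian_radial). *)

(** * Growth rates of a function and of its derivative at 0 *)

(** Cauchy's theorem rather than the plain mean value theorem: measured against
    increments of [t^a], the derivative enters only through [h1 x * x^(1 - a)],
    the quantity whose behaviour at 0 matters, whatever the place of [x] between
    [s] and [r]. *)
Lemma powR_mean_value (R : realType) (h h1 : R -> R) (a s r : R) :
  a != 0 -> 0 < s -> s < r -> (forall t : R, 0 < t -> is_derive t 1 h (h1 t)) ->
  exists2 x, s < x < r &
    h r - h s = h1 x * x `^ (1 - a) / a * (r `^ a - s `^ a).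
Proof.
move=> a0 s0 sr dh.
have pos x : x \in `]s, r[%R -> 0 < x.
  by rewrite in_itv/= => /andP[sx _]; exact: lt_trans sx.
have poscc x : x \in `[s, r]%R -> 0 < x.
  by rewrite in_itv/= => /andP[sx _]; exact: lt_le_trans sx.
have dp x : x \in `]s, r[%R -> a * x `^ (a - 1) != 0.
  by move=> /pos x0; rewrite mulf_neq0// gt_eqF// powR_gt0.
have cwp (k k1 : R -> R) : (forall t : R, 0 < t -> is_derive t 1 k (k1 t)) ->
    {within `[s, r], continuous k}.
  by move=> dk; apply: derivable_within_continuous => x /poscc/dk[].
have dpow (t : R) : 0 < t -> is_derive t 1 (fun x => x `^ a) (a * t `^ (a - 1)).
  by move=> t0; exact: (@is_derive1_powR R a t t0).
have ih x : x \in `]s, r[%R -> is_derive x 1 h (h1 x) by move=> /pos/dh.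
have ip x : x \in `]s, r[%R ->
    is_derive x 1 (fun x => x `^ a) (a * x `^ (a - 1)).
  by move=> /pos/dpow.
have [x xsr xE] := cauchy_MVT sr (cwp _ _ dh) (cwp _ _ dpow) ih ip dp.
have D0 := differentiable_subr_neq0 sr (cwp _ _ dpow) ip dp.
exists x; first by move: xsr; rewrite in_itv.
have x0 := pos x xsr.
rewrite -[LHS](divfK D0) -xE; congr (_ * _).
by rewrite -[1 - a]opprB powRN invfM mulrA mulrAC.
Qed.

(** A limit of [h t / t^a] need not pass to the derivative, but it does along
    some sequence tending to 0: on [t, 2t], the mean value theorem produces a
    point where the quotient of the derivatives of [h] and [t^a] is that of
    their increments, and these increments have the expected ratio because
    [2^a != 1]. *)
Lemma derive_powR_cluster (R : realType) (h h1 : R -> R) (a c : R) :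
  a != 0 -> (forall t : R, 0 < t -> is_derive t 1 h (h1 t)) ->
  h t * t `^ (- a) @[t --> 0^'+] --> c ->
  forall e d : R, 0 < e -> 0 < d ->
    exists2 x : R, 0 < x < d & `|h1 x * x `^ (1 - a) - a * c| < e.
Proof.
move=> a0 dh hc e d e0 d0.
have t2 : 2 * t @[t --> 0^'+] --> (0 : R)^'+.
  move=> A [r /= r0 rA]; exists (r / 2) => /=; first by rewrite divr_gt0.
  move=> t /= + t0; rewrite !sub0r !normrN gtr0_norm// => tr.
  apply: rA => /=; last by rewrite mulr_gt0.
  by rewrite sub0r normrN gtr0_norm ?mulr_gt0//; lra.
have N0 : (2 : R) `^ a - 1 != 0.
  by rewrite subr_eq0 powR_eq1 (negPf a0) orbF; apply/norP; split; lra.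
have Qc : a * (2 `^ a * (h (2 * t) * (2 * t) `^ (- a)) - h t * t `^ (- a))
    / (2 `^ a - 1) @[t --> 0^'+] --> a * (2 `^ a * c - c) / (2 `^ a - 1).
  apply: cvgMl; apply: cvgMr; apply: cvgB => //; apply: cvgMr.
  exact: (cvg_comp _ _ t2 hc).
have {}Qc : a * (2 `^ a * (h (2 * t) * (2 * t) `^ (- a)) - h t * t `^ (- a))
    / (2 `^ a - 1) @[t --> 0^'+] --> a * c.
  suff -> : a * c = a * (2 `^ a * c - c) / (2 `^ a - 1) by [].
  by field.
have [t [t0 td tQ]] : exists t : R, [/\ 0 < t, 2 * t < d &
    `|a * (2 `^ a * (h (2 * t) * (2 * t) `^ (- a)) - h t * t `^ (- a))
    / (2 `^ a - 1) - a * c| < e].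
  near (0 : R)^'+ => t; exists t; split.
  - by near: t; exact: nbhs_right_gt.
  - rewrite mulrC -ltr_pdivlMr//; near: t; apply: nbhs_right_lt.
    by rewrite divr_gt0.
  - by rewrite distrC; near: t; move/cvgrPdist_lt: Qc => /(_ _ e0).
have t2t : t < 2 * t by lra.
have [x /andP[tx xt] xE] := powR_mean_value R h h1 a t (2 * t) a0 t0 t2t dh.
exists x; first by rewrite (lt_trans t0 tx) (lt_trans xt td).
suff -> : h1 x * x `^ (1 - a) = a * (2 `^ a * (h (2 * t) * (2 * t) `^ (- a))
    - h t * t `^ (- a)) / (2 `^ a - 1) by [].
have ta0 : t `^ a != 0 by rewrite gt_eqF// powR_gt0.
have a20 : (2 : R) `^ a != 0 by rewrite gt_eqF// powR_gt0.
rewrite !powRN powRM//; last exact: ltW.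
have -> : 2 `^ a * (h (2 * t) * (2 `^ a * t `^ a)^-1) - h t * (t `^ a)^-1
  = (h (2 * t) - h t) / t `^ a.
  by field; rewrite ta0 a20.
rewrite xE powRM//; last exact: ltW.
by field; rewrite ta0 N0 a0.
Unshelve. all: by end_near. Qed.

(** For [a > 0], [h] is [(c / a) t^a] up to a constant and a smaller term; a
    finite cluster value of [h t / t^a] excludes a nonzero constant.  The proof
    avoids integration by comparing two points [s] and [r] where [h t / t^a] is
    close to [l]. *)
Lemma cluster_powR_derive_lim (R : realType) (h h1 : R -> R) (a c l : R) :
  0 < a -> (forall t : R, 0 < t -> is_derive t 1 h (h1 t)) ->
  h1 t * t `^ (1 - a) @[t --> 0^'+] --> c ->
  (forall e d : R, 0 < e -> 0 < d ->
    exists2 x : R, 0 < x < d & `|h x * x `^ (- a) - l| < e) ->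
  a * l = c.
Proof.
move=> a0 dh h1c hl; apply/eqP; rewrite -subr_eq0 -normr_le0.
apply/ler_addgt0Pr => e e0; rewrite add0r.
(* The three errors below, each at most k, contribute 2 a k + k in total. *)
pose k : R := e / (2 * a + 1).
have k0 : 0 < k by rewrite divr_gt0//; lra.
have kE : e = k * (2 * a + 1) by rewrite divfK//; lra.
have /cvgrPdist_lt/(_ _ k0) [d /= d0 dP] := h1c.
have [r /andP[r0 rd] rl] := hl _ _ k0 d0.
(* Taking s^a < r^a / 3 gives s^a + r^a <= 2 (r^a - s^a), so that the errors at
   both end points are absorbed by the increment of t^a. *)
pose q : R := 1 / 3; have q0 : 0 < q by rewrite /q; lra.
have q1 : q < 1 by rewrite /q; lra.
have [s /andP[s0 sr'] sl] :
    exists2 s : R, 0 < s < r * q `^ a^-1 & `|h s * s `^ (- a) - l| < k.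
  by apply: hl => //; rewrite mulr_gt0// powR_gt0.
have p3 : r * q `^ a^-1 < r.
  rewrite -[ltRHS]mulr1 ltr_pM2l//.
  have <- : (1 : R) `^ a^-1 = 1 by rewrite powR1.
  by apply: gt0_ltr_powR; rewrite ?invr_gt0 ?nnegrE ?ler01 ?ltW.
have sr : s < r by exact: lt_trans p3.
have sar : 3 * s `^ a < r `^ a.
  have : s `^ a < (r * q `^ a^-1) `^ a.
    by apply: gt0_ltr_powR; rewrite ?nnegrE ?mulr_ge0 ?powR_ge0 ?ltW.
  rewrite powRM ?powR_ge0 ?ltW// -powRrM mulVf ?gt_eqF//.
  rewrite powRr1; last exact: ltW.
  by rewrite /q; lra.
have [x /andP[sx xr] xE] :=
  powR_mean_value R h h1 a s r (lt0r_neq0 a0) s0 sr dh.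
have x0 := lt_trans s0 sx.
have xc : `|c - h1 x * x `^ (1 - a)| < k.
  apply: dP => //=; rewrite sub0r normrN gtr0_norm//; exact: lt_trans rd.
have hE t : 0 < t -> h t = h t * t `^ (- a) * t `^ a.
  by move=> t0; rewrite powRN divfK// gt_eqF// powR_gt0.
have s'0 : 0 < s `^ a by rewrite powR_gt0.
have {}xE : a * (h r * r `^ (- a) * r `^ a - h s * s `^ (- a) * s `^ a)
    = h1 x * x `^ (1 - a) * (r `^ a - s `^ a).
  by rewrite -!hE// xE; field; exact: lt0r_neq0.
move: xE rl sl xc sar s'0.
move: (h r * r `^ (- a)) (h s * s `^ (- a)) (h1 x * x `^ (1 - a)).
move: (r `^ a) (s `^ a) => X Y A B C E; rewrite !ltr_norml.
move=> /andP[A1 A2] /andP[B1 B2] /andP[C1 C2] YX Y0.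
rewrite -(@ler_pM2r _ (X - Y)); last by lra.
rewrite -[X in _ * X <= _]gtr0_norm; last by lra.
have -> : `|a * l - c| * `|X - Y|
    = `|a * ((B - l) * Y - (A - l) * X) - (c - C) * (X - Y)|.
  rewrite -normrM; congr `|_|.
  have -> : a * ((B - l) * Y - (A - l) * X)
      = a * l * (X - Y) - a * (A * X - B * Y) by ring.
  by rewrite E; ring.
have BY : `|(B - l) * Y| <= k * Y.
  by rewrite normrM (gtr0_norm Y0) ler_pM2r// ler_norml !ltW.
have AX : `|(A - l) * X| <= k * X.
  have X0 : 0 < X by lra.
  by rewrite normrM (gtr0_norm X0) ler_pM2r// ler_norml !ltW.
have CXY : `|(c - C) * (X - Y)| <= k * (X - Y).
  have XY0 : 0 < X - Y by lra.
  by rewrite normrM (gtr0_norm XY0) ler_pM2r// ler_norml !ltW.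
apply: le_trans (ler_normB _ _) _.
rewrite normrM (gtr0_norm a0) kE.
have BA : `|(B - l) * Y - (A - l) * X| <= k * (2 * (X - Y)).
  apply: le_trans (ler_normB _ _) _; apply: le_trans (lerD BY AX) _.
  by rewrite -mulrDr ler_pM2l//; lra.
have := ler_wpM2l (ltW a0) BA; lra.
Qed.

(** * Derivatives along lines and of functions of the Euclidean norm *)

Lemma is_derive_line (R : realType) (V : normedModType R) (f : V -> R)
    (p v : V) (t d : R) :
  is_derive (t *: v + p) v f d <-> is_derive t 1 (fun s => f (s *: v + p)) d.
Proof.
have E : (fun h : R =>
      h^-1 *: ((f \o shift (t *: v + p)) (h *: v) - f (t *: v + p)))
    = (fun h => h^-1 *:
        (((fun s => f (s *: v + p)) \o shift t) (h *: 1) - f (t *: v + p))).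
  apply/funext => h /=; congr (_ *: (f _ - _)).
  by rewrite [h *: 1]mulr1 scalerDl addrA.
by split=> -[dv <-]; split; rewrite /derivable /derive /= ?E // -?E.
Qed.

Section enorm.
Variables (R : realType) (n : nat).
Implicit Types (x y : 'rV[R]_n) (i : 'I_n).

Lemma dot_self_gt0 x : x != 0 -> 0 < dot x x.
Proof.
move=> x0; rewrite lt_def; apply/andP; split; last first.
  by apply: sumr_ge0 => i _; rewrite -expr2 sqr_ge0.
apply: contra_neq x0 => /eqP; rewrite psumr_eq0; last first.
  by move=> i _; rewrite -expr2 sqr_ge0.
move=> /allP x0; apply/rowP => i; rewrite mxE.
by have := x0 i (mem_index_enum i); rewrite -expr2 sqrf_eq0 => /eqP.
Qed.

Lemma enorm_gt0 x : x != 0 -> 0 < enorm x.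
Proof. by move=> /dot_self_gt0; rewrite sqrtr_gt0. Qed.

Lemma dot_delta i x : dot (delta_mx ord0 i) x = x ord0 i.
Proof.
rewrite /dot (bigD1 i)//= mxE !eqxx mul1r big1 ?addr0// => j ji.
by rewrite mxE (negPf ji) andbF mul0r.
Qed.

Lemma enorm_scale_delta (t : R) i : 0 <= t ->
  enorm (t *: delta_mx ord0 i : 'rV[R]_n) = t.
Proof.
move=> t0; rewrite /enorm.
have -> : dot (t *: delta_mx ord0 i : 'rV[R]_n) (t *: delta_mx ord0 i) = t ^+ 2.
  rewrite /dot (bigD1 i)//= !mxE !eqxx mulr1 big1 ?addr0// => j ji.
  by rewrite !mxE (negPf ji) andbF mulr0 mul0r.
by rewrite sqrtr_sqr ger0_norm.
Qed.

Lemma is_derive_coord x i :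
  is_derive x (delta_mx ord0 i) (fun y : 'rV[R]_n => y ord0 i) (1 : R).
Proof.
rewrite -[x]add0r -(scale0r (delta_mx ord0 i)); apply/is_derive_line.
rewrite (_ : (fun s : R => _) = (fun s => s + x ord0 i)); last first.
  by apply/funext => s; rewrite !mxE !eqxx mulr1.
by apply: is_derive_eq; rewrite addr0.
Qed.

Lemma is_derive_enorm x i : x != 0 ->
  is_derive x (delta_mx ord0 i) (@enorm R n) (x ord0 i / enorm x).
Proof.
move=> x0; rewrite -{1}[x]add0r -(scale0r (delta_mx ord0 i)).
apply/is_derive_line.
rewrite (_ : (fun s : R => _) =
  Num.sqrt \o (fun s => s ^+ 2 + s * (2 * x ord0 i) + dot x x)); last first.
  apply/funext => s /=; rewrite /enorm; congr Num.sqrt.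
  rewrite -(dot_delta i x).
  pose v : 'rV[R]_n := delta_mx ord0 i; rewrite -/v.
  have E : dot (s *: v + x) (s *: v + x) = \sum_(j < n)
      (s ^+ 2 * (v ord0 j * v ord0 j) + s * 2 * (v ord0 j * x ord0 j)
        + x ord0 j * x ord0 j).
    by apply: eq_bigr => j _; rewrite !mxE; ring.
  rewrite E !big_split/= -!mulr_sumr -/(dot _ x) -/(dot v v) -/(dot x x).
  by rewrite !dot_delta !mxE !eqxx andbT -[true%:R]/1; ring.
have q0 : 0 < (fun s => s ^+ 2 + s * (2 * x ord0 i) + dot x x) 0.
  by rewrite expr0n/= mul0r !add0r dot_self_gt0.
have dq : is_derive (0 : R) 1
    (fun s => s ^+ 2 + s * (2 * x ord0 i) + dot x x) (2 * x ord0 i).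
  rewrite (_ : (fun s => _) =
    (@id R) ^+ 2 + (@id R) * cst (2 * x ord0 i) + cst (dot x x)).
    by apply: is_derive_eq; rewrite /GRing.scale /=; ring.
  by apply/funext.
have := @is_derive1_comp R Num.sqrt _ 0 _ _ (is_derive1_sqrt q0) dq.
move=> dE; apply: is_derive_eq dE _.
rewrite /= expr0n/= mul0r !add0r -/(enorm x).
by field; rewrite gt_eqF// enorm_gt0.
Qed.

Lemma is_derive_radial x i (u : R -> R) (d : R) : x != 0 ->
  is_derive (enorm x) 1 u d ->
  is_derive x (delta_mx ord0 i) (fun y => u (enorm y))
    (d * (x ord0 i / enorm x)).
Proof.
move=> x0 du; have := is_derive_enorm x i x0.
rewrite -{1 4}[x]add0r -(scale0r (delta_mx ord0 i)).
move=> /is_derive_line de; apply/is_derive_line.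
have := @is_derive1_comp R u _ 0 d _ _ de.
by rewrite scale0r add0r; apply.
Qed.

(** Away from 0 the first partial derivatives of [u (enorm y)] are
    [k (enorm y) * y_i] with [k r = u' r / r]; differentiating this product once
    more and using that the [x_i ^ 2] add up to [r ^ 2] gives the formula. *)
Lemma laplacian_radial (F : 'rV[R]_n -> R) (u u1 : R -> R) (u2 : R) x :
  (forall y, y != 0 -> F y = u (enorm y)) ->
  (forall r : R, 0 < r -> is_derive r 1 u (u1 r)) ->
  x != 0 -> is_derive (enorm x) 1 u1 u2 ->
  laplacian F x = u2 + (n%:R - 1) * (u1 (enorm x) / enorm x).
Proof.
move=> FE du x0 du1.
have near0 y : y != 0 -> \forall z \near y, z != 0.
  move=> y0; apply: open_nbhs_nbhs; split => //.
  rewrite (_ : (fun z => _) = ~` [set 0]); last first.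
    by apply/funext => z; apply/propext; split => /eqP.
  rewrite openC; apply: accessible_closed_set1.
  apply: hausdorff_accessible; exact: norm_hausdorff.
have r0 := enorm_gt0 x x0.
have pE i y : y != 0 -> partial i F y = u1 (enorm y) / enorm y * y ord0 i.
  move=> y0; apply: derive_val.
  apply: (@near_eq_is_derive _ _ _ (fun y => u (enorm y))).
    by have := near0 y y0; apply: filterS => z /FE.
  have dF := is_derive_radial y i u _ y0 (du _ (enorm_gt0 y y0)).
  by apply: is_derive_eq dF _; lra.
have ppE i : partial i (partial i F) x =
   (u2 / enorm x ^+ 2 - u1 (enorm x) / enorm x ^+ 3) * (x ord0 i * x ord0 i)
     + u1 (enorm x) / enorm x.
  apply: derive_val.
  apply: (@near_eq_is_derive _ _ _
    ((fun y => u1 (enorm y) / enorm y) * (fun y : 'rV[R]_n => y ord0 i))).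
    by have := near0 x x0; apply: filterS => y /pE->.
  have dk : is_derive (enorm x) 1 (fun r => u1 r / r)
      (u2 / enorm x - u1 (enorm x) / enorm x ^+ 2).
    have dr := @is_derive_id R R (enorm x) 1.
    have := is_deriveM du1 (@is_deriveV R id _ _ _ (lt0r_neq0 r0) dr).
    move=> dE; apply: is_derive_eq dE _; rewrite /GRing.scale /=.
    by field; exact: lt0r_neq0.
  have dk' := is_derive_radial x i _ _ x0 dk.
  apply: is_derive_eq (is_deriveM dk' (is_derive_coord x i)) _.
  rewrite /GRing.scale /=; field; exact: lt0r_neq0.
rewrite /laplacian (eq_bigr _ (fun i _ => ppE i)) big_split/= -mulr_sumr.
rewrite sumr_const card_ord -/(dot x x).
have -> : dot x x = enorm x ^+ 2 by rewrite sqr_sqrtr// ltW// dot_self_gt0.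
rewrite -mulr_natl; field; exact: lt0r_neq0.
Qed.
End enorm.

(** * The radial equation near the origin *)

(** The flux [W] turns the equation into a formula for [W'] without [g1], so
    that the limit of [t^gamma g] determines that of [W' t^(gamma - n + 1)]; its
    cluster values come from [derive_powR_cluster] applied to [g^m / m], which
    behaves like [t^(2 - gamma)]. *)
Lemma radial_profile_limit (R : realType) (n : nat) (m alpha beta gamma eta : R)
    (g g1 u1 u2 : R -> R) :
  (1 < n)%N -> 0 < m -> m < (n%:R - 2) / n%:R -> gamma = 2 / (1 - m) ->
  0 < eta -> (forall t : R, 0 < t -> 0 < g t) ->
  (forall t : R, 0 < t -> is_derive t 1 g (g1 t)) ->
  (forall t : R, 0 < t -> is_derive t 1 (fun r => g r `^ m / m) (u1 t)) ->
  (forall t : R, 0 < t -> is_derive t 1 u1 (u2 t)) ->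
  (forall t : R, 0 < t -> u2 t + (n%:R - 1) * (u1 t / t) + alpha * g t
     + beta * (t * g1 t) = 0) ->
  t `^ gamma * g t @[t --> 0^'+] --> eta ->
  (alpha - 2 * beta / (1 - m)) * eta `^ (1 - m)
    = 2 * (n%:R - 2 - n%:R * m) / (1 - m) ^+ 2.
Proof.
move=> n1 m0 mn gE eta0 g0 dg du du1 ode geta.
have [N nE] : exists N, n = N.+2.
  by case: n n1 {mn ode} => [|[|N]]// _; exists N.
have nR : n%:R = N%:R + 2 :> R by rewrite nE -addn2 natrD.
have N0 : 0 <= N%:R :> R by rewrite ler0n.
have {}mn : n%:R * m < n%:R - 2 by rewrite mulrC -ltr_pdivlMr//; lra.
have m1 : 0 < 1 - m by nra.
have gm : gamma * m = gamma - 2 by rewrite gE; field; exact: lt0r_neq0.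
have g2 : 2 - gamma != 0.
  rewrite -opprB -gm oppr_eq0 mulf_neq0 ?lt0r_neq0//.
  by rewrite gE divr_gt0.
have ng : 0 < n%:R - gamma.
  by rewrite gE subr_gt0 ltr_pdivrMr//; lra.
pose W t := t ^+ N.+1 * u1 t + beta * (t ^+ N.+2 * g t).
have dW (t : R) : 0 < t ->
    is_derive t 1 W ((n%:R * beta - alpha) * (t ^+ N.+1 * g t)).
  move=> t0.
  have dt k : is_derive t 1 (fun s : R => s ^+ k) (k%:R * t ^+ k.-1).
    have := is_deriveX k (@is_derive_id R R t 1); rewrite exprfctE.
    by move=> dE; apply: is_derive_eq dE _; rewrite /GRing.scale /= mulr1.
  have := is_deriveD (is_deriveM (dt N.+1) (du1 t t0))
    (is_deriveM (is_derive_cst beta t 1) (is_deriveM (dt N.+2) (dg t t0))).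
  move=> dE; apply: is_derive_eq dE _; rewrite /GRing.scale /= mulr0 addr0.
  have -> : u2 t =
      - ((n%:R - 1) * (u1 t / t) + alpha * g t + beta * (t * g1 t)).
    by apply/eqP; rewrite -addr_eq0 !addrA ode.
  have -> : n%:R = N%:R + 2 :> R by [].
  rewrite -!natr1 !exprS.
  by field; exact: lt0r_neq0.
have powE (t b c : R) (k : nat) : 0 < t -> k%:R + b = c ->
    t ^+ k * t `^ b = t `^ c.
  by move=> t0 <-; rewrite -powR_mulrn ?ltW// -powRD// (gt_eqF t0) implybT.
have W1 (t : R) : 0 < t ->
    (n%:R * beta - alpha) * (t ^+ N.+1 * g t) * t `^ (1 - (n%:R - gamma))
    = (n%:R * beta - alpha) * (t `^ gamma * g t).
  move=> t0; rewrite -(powE t (1 - (n%:R - gamma)) gamma N.+1)//; first by ring.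
  by rewrite nR -natr1; ring.
have W1c : (n%:R * beta - alpha) * (t ^+ N.+1 * g t) * t `^ (1 - (n%:R - gamma))
    @[t --> 0^'+] --> (n%:R * beta - alpha) * eta.
  apply: (@cvg_trans _
    ((n%:R * beta - alpha) * (t `^ gamma * g t) @[t --> 0^'+])).
    by apply: near_eq_cvg; near=> t; rewrite W1.
  exact: cvgMr.
have uc : g t `^ m / m * t `^ (- (2 - gamma)) @[t --> 0^'+] --> eta `^ m / m.
  apply: (@cvg_trans _ ((t `^ gamma * g t) `^ m / m @[t --> 0^'+])).
    apply: near_eq_cvg; near=> t.
    have t0 : 0 < t by near: t; exact: nbhs_right_gt.
    rewrite powRM ?powR_ge0 ?ltW ?g0// -powRrM gm opprB; ring.
  apply: cvgMl.
  have [/derivable1_diffP/differentiable_continuous pc _] :=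
    is_derive1_powR m eta0.
  exact: (cvg_comp (fun t => t `^ gamma * g t) (fun x => x `^ m) geta pc).
have Wl (e d : R) : 0 < e -> 0 < d -> exists2 x : R, 0 < x < d &
    `|W x * x `^ (- (n%:R - gamma))
      - ((2 - gamma) * (eta `^ m / m) + beta * eta)| < e.
  move=> e0 d0.
  have e2 : 0 < e / 2 by rewrite divr_gt0.
  have : beta * (t `^ gamma * g t) @[t --> 0^'+] --> beta * eta by exact: cvgMr.
  move=> /cvgrPdist_lt/(_ _ e2) [d' /= d'0 dP].
  have dd' : 0 < Num.min d d' by rewrite lt_min d0.
  have [x /andP[x0 xd] xu] :=
    derive_powR_cluster R _ u1 _ _ g2 du uc _ _ e2 dd'.
  move: xd; rewrite lt_min => /andP[xd xd'].
  exists x; first by rewrite x0.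
  have xb : `|beta * eta - beta * (x `^ gamma * g x)| < e / 2.
    by apply: dP => //=; rewrite sub0r normrN gtr0_norm.
  have -> : W x * x `^ (- (n%:R - gamma)) =
     u1 x * x `^ (1 - (2 - gamma)) + beta * (x `^ gamma * g x).
    rewrite /W -(powE x (- (n%:R - gamma)) (1 - (2 - gamma)) N.+1)//;
      last first.
      by rewrite nR -natr1; ring.
    rewrite -(powE x (- (n%:R - gamma)) gamma N.+2)//; first by ring.
    by rewrite nR -!natr1; ring.
  rewrite [- (_ * _ + _ * _)]opprD addrACA.
  apply: le_lt_trans (ler_normD _ _) _.
  by rewrite distrC in xb; lra.
have := cluster_powR_derive_lim R W _ _ _ _ ng dW W1c Wl.
have etaE : eta = eta `^ m * eta `^ (1 - m).
  by rewrite -powRD ?(gt_eqF eta0) ?implybT// subrKC powRr1// ltW.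
have em0 : 0 < eta `^ m by rewrite powR_gt0.
move: etaE em0; move: (eta `^ (1 - m)) (eta `^ m) => E M -> M0 H.
have -> : E = m * E / m by rewrite mulrC mulKf// lt0r_neq0.
have P0 : M / m != 0 by rewrite mulf_neq0 ?invr_neq0 ?lt0r_neq0.
have {}H : (n%:R - gamma) * (2 - gamma) = (gamma * beta - alpha) * (m * E).
  apply: (mulfI P0).
  have ME : M * E = (M / m) * (m * E) by field; exact: lt0r_neq0.
  move: H; rewrite ME; lra.
have {}H : (alpha - gamma * beta) * (m * E) = (n%:R - gamma) * (gamma - 2).
  by lra.
have -> : 2 * beta / (1 - m) = gamma * beta by rewrite gE; ring.
rewrite mulrA H gE; field; rewrite !lt0r_neq0.
Unshelve. all: by end_near. Qed.

(** * From the radial equation to the theorem *)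

Lemma cvg_ray_dnbhs (R : realType) (V : normedModType R) (v : V) :
  v != 0 -> t *: v @[t --> (0 : R)^'+] --> (0 : V)^'.
Proof.
move=> v0 A A0.
have c0 : t *: v @[t --> (0 : R)] --> (0 : V).
  by rewrite -(scale0r v); exact: scalel_continuous.
have H : \forall t \near (0 : R), t *: v != 0 -> A (t *: v) by exact: c0 _ A0.
suff : \forall t \near (0 : R)^'+, A (t *: v) by [].
rewrite near_withinE; near=> t => t0.
have : t *: v != 0 -> A (t *: v) by near: t.
by apply; rewrite scaler_eq0 negb_or v0 andbT gt_eqF.
Unshelve. all: by end_near. Qed.

Theorem theorem1p4 (R : realType) (n : nat) (m alpha beta gamma eta : R)
  (hn : (3 <= n)%N) (hm0 : 0 < m) (hm : m < (n%:R - 2) / n%:R)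
  (hgamma : gamma = 2 / (1 - m)) (heta : 0 < eta)
  (hf : exists f : 'rV[R]_n -> R,
    [/\ solution m alpha beta f,
        radial f
      & enorm x `^ gamma * f x @[x --> (0 : 'rV[R]_n)^'] --> eta]) :
  (alpha - 2 * beta / (1 - m)) * eta `^ (1 - m)
    = 2 * (n%:R - 2 - n%:R * m) / (1 - m) ^+ 2.
Proof.
case: hf => f [[[C1 C2] fpos eqf] frad flim].
have n0 : (0 < n)%N by exact: leq_trans hn.
pose i0 := Ordinal n0; pose v : 'rV[R]_n := delta_mx ord0 i0.
have v0 : v != 0.
  by apply/eqP => /rowP /(_ i0); rewrite !mxE !eqxx => /eqP; rewrite oner_eq0.
have tv0 (t : R) : 0 < t -> t *: v != 0.
  by move=> t0; rewrite scaler_eq0 negb_or v0 gt_eqF.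
pose g (t : R) := f (t *: v).
pose g1 (t : R) := partial i0 f (t *: v).
pose g2 (t : R) := partial i0 (partial i0 f) (t *: v).
have dray (F : 'rV[R]_n -> R) (t : R) : derivable F (t *: v) v ->
    is_derive t 1 (fun s => F (s *: v)) ('D_v F (t *: v)).
  move=> /derivableP dF.
  have := @is_derive_line R _ F 0 v t ('D_v F (t *: v)).
  rewrite addr0 => -[+ _] => /(_ dF).
  by under eq_fun do rewrite addr0.
have dg (t : R) : 0 < t -> is_derive t 1 g (g1 t).
  by move=> /tv0 t0; apply: dray; have [] := C1 _ i0 t0.
have dg1 (t : R) : 0 < t -> is_derive t 1 g1 (g2 t).
  by move=> /tv0 t0; apply: dray; have [] := C2 i0 _ i0 t0.
have gpos (t : R) : 0 < t -> 0 < g t by move=> /tv0/fpos.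
have dpow (b t : R) : 0 < t ->
    is_derive t 1 (fun s => g s `^ b) (b * g t `^ (b - 1) * g1 t).
  move=> t0.
  exact: (@is_derive1_comp R (fun x => x `^ b) g t _ _
    (is_derive1_powR b (gpos t t0)) (dg t t0)).
pose u (t : R) := g t `^ m / m.
pose u1 (t : R) := g t `^ (m - 1) * g1 t.
have du (t : R) : 0 < t -> is_derive t 1 u (u1 t).
  move=> t0; have := is_deriveM (dpow m t t0) (is_derive_cst m^-1 t 1).
  move=> dE; apply: is_derive_eq dE _; rewrite /GRing.scale /= /u1.
  by field; exact: lt0r_neq0.
have du1 (t : R) : 0 < t -> is_derive t 1 u1 ('D_1 u1 t).
  move=> t0; apply: derivableP.
  by have [] := is_deriveM (dpow (m - 1) t t0) (dg1 t t0).
apply: (radial_profile_limit R n m alpha beta gamma eta g g1 u1 ('D_1 u1)) => //.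
- exact: ltnW.
- move=> t t0.
  have := eqf _ (tv0 t t0).
  have FE y : y != 0 -> f y `^ m / m = u (enorm y).
    move=> y0; rewrite /u /g (frad y (enorm y *: v))//.
      by apply: tv0; exact: enorm_gt0.
    by rewrite enorm_scale_delta// ltW// enorm_gt0.
  have et : enorm (t *: v) = t by rewrite enorm_scale_delta// ltW.
  have := laplacian_radial R n _ u u1 ('D_1 u1 t) (t *: v) FE du (tv0 t t0).
  rewrite et => /(_ (du1 t t0)) ->.
  suff -> : dot (t *: v) (grad f (t *: v)) = t * g1 t by [].
  have -> : dot (t *: v) (grad f (t *: v)) = t * dot v (grad f (t *: v)).
    by rewrite /dot mulr_sumr; apply: eq_bigr => j _; rewrite !mxE mulrA.
  by rewrite dot_delta mxE.
- apply: (@cvg_trans _ (enorm (t *: v) `^ gamma * f (t *: v) @[t --> 0^'+])).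
    apply: near_eq_cvg; near=> t.
    by rewrite enorm_scale_delta//; near: t; exact: nbhs_right_ge.
  exact: (cvg_comp _ _ (cvg_ray_dnbhs R _ v v0) flim).
Unshelve. all: by end_near. Qed.
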